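(* Let $d\ge1$ and $A\in H_{2d}^+(\mathbb{C})$ satisfy Assumptions I and II. Then for all $w\in\mathcal{S}$, $\langle u_{1/\overline{w}},\Phi'(w)u_w\rangle\neq0$. Define, for $w\in\mathcal{S}$, $\alpha_w\in\mathbb{C}^*$ and $P_w\in M_d(\mathbb{C})$ by $$\alpha_w=\frac{1}{\langle u_{1/\overline{w}},\Phi'(w)u_w\rangle},\qquad P_wx=\langle u_{1/\overline{w}},x\rangle u_w\quad(x\in\mathbb{C}^d).$$ Then for all $z\in\mathbb{C}^*\setminus\mathcal{S}$, $$\Phi(z)^{-1}=\sum_{w\in\mathcal{S}}\frac{\alpha_w}{z-w}P_w=\sum_{w\in\mathcal{S}_{<1}}\left(\frac{\alpha_w}{z-w}P_w+\frac{\alpha_{1/\overline{w}}}{z-1/\overline{w}}P_{1/\overline{w}}\right).$$ Moreover, $(u_w)_{w\in\mathcal{S}_{<1}}$ and $(u_w)_{w\in\mathcal{S}_{>1}}$ are bases of $\mathbb{C}^d$.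
   Context: $H_n^+(\mathbb{C})$ is the set of $n\times n$ complex Hermitian positive definite matrices; $\langle x,y\rangle=x^*y$ on $\mathbb{C}^d$. A matrix $A\in H_{2d}^+(\mathbb{C})$ is written in $d\times d$ blocks $A=\begin{pmatrix} A_{LL} & A_{LR} \\ A_{RL} & A_{RR} \end{pmatrix}$. Define $\Phi(z)=A_{LL}+A_{RR}+A_{LR}z+A_{RL}z^{-1}\in M_d(\mathbb{C})$ for $z\in\mathbb{C}^*$ (with complex derivative $\Phi'$), $\mathcal{S}=\{z\in\mathbb{C}^*:\det\Phi(z)=0\}$, $\mathcal{S}_{<1}=\{w\in\mathcal{S}:|w|<1\}$, $\mathcal{S}_{>1}=\{w\in\mathcal{S}:|w|>1\}$. One has $\Phi(1/\overline{z})=\Phi(z)^*$, so $w\in\mathcal{S}$ iff $1/\overline{w}\in\mathcal{S}$, and $\Phi(z)$ is Hermitian positive definite for $|z|=1$, so $\mathcal{S}=\mathcal{S}_{<1}\sqcup\mathcal{S}_{>1}$. Assumption I: $\mathrm{rank}(A_{LR})=d$. Assumption II: every $w\in\mathcal{S}$ is a simple root of the polynomial $z^d\det\Phi(z)$ and $\dim\ker\Phi(w)=1$. For each $w\in\mathcal{S}$ a vector $u_w\neq0$ spanning $\ker\Phi(w)$ is fixed. *)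

(* Defs.v *)
From HB Require Import structures.
From mathcomp Require Import all_boot all_order all_algebra finmap.
From mathcomp Require Import sesquilinear spectral.
From mathcomp Require Import complex.
From mathcomp Require Import all_classical all_reals all_analysis.

Set Implicit Arguments.
Unset Strict Implicit.
Unset Printing Implicit Defensive.

Import Order.TTheory GRing.Theory Num.Theory.
Import numFieldNormedType.Exports.

Local Open Scope classical_set_scope.
Local Open Scope ring_scope.
Local Open Scope sesquilinear_scope.

Section Defs.
Variable C : numClosedFieldType.

(* Conjugate-linear in the first argument: <x, y> = x^* y. *)
Definition inner (d : nat) (x y : 'cV[C]_d) : C := (x ^t* *m y) 0 0.

(* 0 < z in a numClosedFieldType entails that z is real. *)
Definition hermitian_posdef (n : nat) (A : 'M[C]_n) : Prop :=
  A ^t* = A /\ forall x : 'cV[C]_n, x != 0 -> 0 < inner x (A *m x).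

Definition mxker (d : nat) (M : 'M[C]_d) : {vspace 'cV[C]_d} :=
  lker (linfun (mulmx M : 'cV[C]_d -> 'cV[C]_d)).

Section Symbol.
Variables (d : nat) (A : 'M[C]_(d + d)).

Let ALL : 'M[C]_d := ulsubmx A.
Let ALR : 'M[C]_d := ursubmx A.
Let ARL : 'M[C]_d := dlsubmx A.
Let ARR : 'M[C]_d := drsubmx A.

Definition Phi (z : C) : 'M[C]_d := ALL + ARR + z *: ALR + z^-1 *: ARL.

(* derive1 over the field C itself, i.e. the complex derivative. *)
Definition dPhi (z : C) : 'M[C]_d := derive1 Phi z.

(* The polynomial z^d det Phi(z), as the determinant of z Phi(z). *)
Definition detPhi_poly : {poly C} :=
  \det ('X *: map_mx polyC (ALL + ARR) + 'X^2 *: map_mx polyC ALR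
        + map_mx polyC ARL).

Lemma detPhi_polyE (z : C) : z != 0 ->
  detPhi_poly.[z] = z ^+ d * \det (Phi z).
Proof.
move=> z0; rewrite /detPhi_poly -detZ -horner_evalE -det_map_mx; congr (\det _).
apply/matrixP => i j; rewrite !mxE /= !horner_evalE !hornerE /=.
by rewrite !mulrDr !mulrA -expr2 mulfV // mul1r.
Qed.

Definition Sset : set C := [set z | z != 0 /\ \det (Phi z) = 0].
Definition Sset_lt1 : set C := [set w | Sset w /\ `|w| < 1].
Definition Sset_gt1 : set C := [set w | Sset w /\ 1 < `|w|].

Definition assumption_I : Prop := \rank ALR = d.

Definition assumption_II : Prop :=
  forall w, Sset w -> mup w detPhi_poly = 1%N /\ \dim (mxker (Phi w)) = 1%N.

Section KernelVectors.
Variable u : C -> 'cV[C]_d.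

Definition spanning_kernels : Prop :=
  forall w, Sset w -> u w != 0 /\ <[u w]>%VS = mxker (Phi w).

Definition alpha (w : C) : C :=
  (inner (u (w^*)^-1) (dPhi w *m u w))^-1.

Definition Pmx (w : C) : 'M[C]_d := u w *m (u (w^*)^-1) ^t*.

Lemma Pmx_mul (w : C) (x : 'cV[C]_d) :
  Pmx w *m x = inner (u (w^*)^-1) x *: u w.
Proof. by rewrite /Pmx /inner -mulmxA [X in _ *m X]mx11_scalar mul_mx_scalar. Qed.

End KernelVectors.
End Symbol.

(* fset_set S is a duplicate-free enumeration of S, and is empty when S is
   infinite; for d > 0 the predicate therefore forces S to be finite. *)
Definition is_basis_on (d : nat) (S : set C) (u : C -> 'cV[C]_d) : Prop :=
  basis_of fullv [seq u w | w <- enum_fset (fset_set S)].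

End Defs.

(* Main.v *)
(** With Q(z) = z Phi(z), a quadratic matrix polynomial, Assumption I makes
    q = det Q of degree exactly 2d with q(0) <> 0, so by Assumption II S consists
    of 2d simple roots.  As adj Q has degree at most 2d - 2, Phi(z)^-1 =
    z adj Q(z) / q(z) expands in partial fractions with residues
    w adj Q(w) / q'(w).  The kernels of Phi(w) and of its adjoint are lines, so
    adj Q(w) = c u_w u_{1/w^*}^*, and the identity adj Q(z) Q(z) u_w = q(z) u_w,
    divided by z - w and taken at w, reads c w <u_{1/w^*}, Phi'(w) u_w> = q'(w).
    This gives both the nonvanishing and the value of alpha_w.

    For the bases, a relation sum c_w u_w = 0 over |w| < 1 yields a decaying
    sequence x_n = sum c_w w^n u_w with x_0 = 0 and
    A_RL x_n + (A_LL + A_RR) x_{n+1} + A_LR x_{n+2} = 0.  The energies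
    <y_n, A y_n>, y_n = (x_n, x_{n+1}), telescope to a boundary term which tends
    to 0; they are nonnegative, so all x_n vanish, and Vandermonde gives c = 0.
    Both families are thus free with at most d elements; they have 2d in all. *)

Require Import Defs.
From HB Require Import structures.
From mathcomp Require Import all_boot all_order all_algebra sesquilinear spectral.
From mathcomp Require Import complex.
From mathcomp Require Import perm ring.
From mathcomp Require Import all_classical all_reals all_analysis.

Set Implicit Arguments.
Unset Strict Implicit.
Unset Printing Implicit Defensive.

Import Order.TTheory GRing.Theory Num.Theory.
Import numFieldNormedType.Exports.

Local Open Scope classical_set_scope.
Local Open Scope ring_scope.

(** Away from [h = 0] and [h = - z] the difference quotient has a closed form in which only
    [(h + z)^-1] depends on [h]. *)
Lemma dPhiE (C : numClosedFieldType) (d : nat) (A : 'M[C]_(d + d)) (z : C) :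
  z != 0 -> dPhi A z = ursubmx A - z ^- 2 *: dlsubmx A.
Proof.
move=> z0.
have cvz : (h + z) @[h --> (0 : C)^'] --> z.
  rewrite -[X in _ --> X]add0r; apply: cvgD; last exact: cvg_cst.
  exact: cvg_within.
rewrite /dPhi /derive1; apply: cvg_lim; first exact: norm_hausdorff.
apply: (@cvg_trans _ ((fun h : C =>
    ursubmx A - ((h + z)^-1 / z) *: dlsubmx A) @ 0^')).
  apply: near_eq_cvg; near=> h.
  have h0 : h != 0 by near: h; exact: nbhs_dnbhs_neq.
  have hz0 : h + z != 0 by near: h; exact: (cvgr_neq0 _ cvz).
  have hzV : (h + z)^-1 - z^-1 = - (h * ((h + z)^-1 / z)).
    by field; rewrite hz0 z0.
  rewrite /Phi [X in _ = _ *: X](_ : _ =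
    h *: (ursubmx A - ((h + z)^-1 / z) *: dlsubmx A)); last first.
    rewrite scalerBr scalerA -scaleNr -hzV scalerDl !scalerBl.
    by apply/matrixP => i j; rewrite !mxE; ring.
  by rewrite scalerK.
apply: cvgB; first exact: cvg_cst.
rewrite -exprVn expr2.
apply: cvgZr_tmp; apply: cvgMr_tmp.
exact: cvgV.
Unshelve. all: by end_near.
Qed.

(** * Determinants of polynomial matrices and partial fractions at simple poles *)

Section PartialFractions.
Variable F : fieldType.

Lemma size_det_leq (n k : nat) (M : 'M[{poly F}]_n) :
  (forall i j, size (M i j) <= k.+1)%N -> (size (\det M) <= (n * k).+1)%N.
Proof.
move=> sM; rewrite /determinant; apply: (leq_trans (size_sum _ _ _)).
apply/bigmax_leqP => s _; rewrite mulr_sign.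
rewrite (fun_if (fun p : {poly F} => size p)) size_polyN if_same.
apply: (leq_trans (size_poly_prod_leq _ _)); rewrite card_ord.
have : (\sum_(i < n) size (M i (s i)) <= \sum_(i < n) k.+1)%N by exact: leq_sum.
by rewrite sum_nat_const card_ord mulnS leq_subLR addnS ltnS.
Qed.

Lemma coefM_top (p q : {poly F}) (m n : nat) :
  (size p <= m.+1)%N -> (size q <= n.+1)%N -> (p * q)`_(m + n) = p`_m * q`_n.
Proof.
move=> sp sq; rewrite coefM.
have mlt : (m < (m + n).+1)%N by rewrite ltnS leq_addr.
rewrite (bigD1 (Ordinal mlt)) //= addKn big1 ?addr0 // => i.
rewrite -val_eqE /= neq_ltn => /orP[im|mi].
  rewrite (nth_default _ (leq_trans sq _)) ?mulr0 //.
  by rewrite ltn_subRL ltn_add2r.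
by rewrite (nth_default _ (leq_trans sp _)) ?mul0r.
Qed.

(** By [coefM_top], extracting top coefficients relative to fixed degree bounds is multiplicative,
    hence compatible with each term of the Leibniz expansion. *)
Lemma coef_det_top (n k : nat) (M : 'M[{poly F}]_n) :
  (forall i j, size (M i j) <= k.+1)%N ->
  (\det M)`_(n * k) = \det (map_mx (fun p : {poly F} => p`_k) M).
Proof.
move=> sM; rewrite /determinant coef_sum; apply: eq_bigr => s _.
rewrite !mulr_sign.
rewrite (fun_if (fun p : {poly F} => p`_(n * k))) coefN.
suff -> : (\prod_i M i (s i))`_(n * k) =
    \prod_i (map_mx (fun p : {poly F} => p`_k) M) i (s i) by [].
have [_] : (size (\prod_i M i (s i))%R <= (\sum_(i < n) k).+1)%N /\
    (\prod_i M i (s i))`_(\sum_(i < n) k) = \prod_i (M i (s i))`_k.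
  (* [Q] carries the degree bound along with the coefficient, since [coefM_top] needs a bound on the
     partial product. *)
  pose Q (x : F) (m : nat) (p : {poly F}) := (size p <= m.+1)%N /\ p`_m = x.
  apply: (@big_rec3 _ _ _ Q) => [|i x m p _ [sp <-]].
    by rewrite /Q size_poly1 coef1.
  rewrite /Q coefM_top //; split=> //; apply: (leq_trans (size_polyMleq _ _)).
  by rewrite -ltnS; move: (leq_add (sM i (s i)) sp); rewrite addSn addnS; case: (_ + _)%N.
rewrite sum_nat_const card_ord => ->.
by apply: eq_bigr => i _; rewrite !mxE.
Qed.

Lemma deriv_prod_XsubC_neq0 (c : F) (r : seq F) (w : F) :
  c != 0 -> uniq r -> w \in r ->
  (c *: \prod_(x <- r) ('X - x%:P))^`().[w] != 0.
Proof.
move=> c0 ur wr; rewrite (big_rem w wr) derivZ derivM derivXsubC mul1r hornerZ.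
rewrite hornerD hornerM hornerXsubC subrr mul0r addr0 mulf_neq0 //.
rewrite -[_ != 0]/(~~ root _ _) root_prod_XsubC mem_rem_uniq //.
by rewrite inE /= eqxx.
Qed.

(** Lagrange interpolation of [p] at the nodes [r], divided by [q]: with [l w] the product of the
    other linear factors, the derivative of [q] at [w] is [c * (l w).[w]]. *)
Lemma partial_fractions (p q : {poly F}) (r : seq F) (c : F) :
  q = c *: \prod_(w <- r) ('X - w%:P) -> c != 0 -> uniq r ->
  (size p <= size r)%N -> forall z, z \notin r ->
  p.[z] / q.[z] = \sum_(w <- r) p.[w] / q^`().[w] / (z - w).
Proof.
move=> qE c0 ur sp z zr.
pose l w := \prod_(x <- rem w r) ('X - x%:P).
have ql w : w \in r -> q = c *: (('X - w%:P) * l w).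
  by move=> wr; rewrite qE (big_rem w wr).
have lw0 w : w \in r -> (l w).[w] != 0.
  move=> wr; rewrite -[_ != 0]/(~~ root _ _) root_prod_XsubC mem_rem_uniq //.
  by rewrite inE /= eqxx.
have dq w : w \in r -> q^`().[w] = c * (l w).[w].
  move=> /ql ->; rewrite derivZ derivM derivXsubC mul1r hornerZ hornerD hornerM.
  by rewrite !hornerE subrr mul0r addr0.
(* The interpolation error has size at most [size r] and vanishes at the distinct nodes in [r]. *)
pose D := p - \sum_(w <- r) (p.[w] / (l w).[w]) *: l w.
have D0 : D = 0.
  apply: (@roots_geq_poly_eq0 _ _ r) => //; last first.
    apply: (leq_trans (size_polyD _ _)); rewrite geq_max sp size_polyN /=.
    rewrite big_seq; apply: (big_ind (fun p : {poly F} => size p <= size r)%N).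
    - by rewrite size_poly0.
    - move=> a b ha hb; apply: (leq_trans (size_polyD _ _)).
      by rewrite geq_max ha hb.
    move=> w wr; apply: (leq_trans (size_scale_leq _ _)).
    by rewrite size_prod_XsubC size_rem // prednK //; case: (r) wr.
  apply/allP => x xr; rewrite /root /D hornerD hornerN horner_sum.
  rewrite (bigD1_seq x) //= hornerZ divfK ?lw0 // big1_seq ?addr0 ?subrr //.
  move=> w /andP[wx wr]; rewrite hornerZ.
  suff /eqP -> : root (l w) x by rewrite mulr0.
  by rewrite root_prod_XsubC mem_rem_uniq // inE eq_sym wx.
have pE : p = \sum_(w <- r) (p.[w] / (l w).[w]) *: l w.
  by apply/eqP; rewrite -subr_eq0 -/D D0.
rewrite [in LHS]pE horner_sum big_distrl /= big_seq [RHS]big_seq; apply: eq_bigr => w wr.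
have zw : z - w != 0 by rewrite subr_eq0; apply: contraNneq zr => ->.
have lz0 : (l w).[z] != 0.
  rewrite -[_ != 0]/(~~ root _ _) root_prod_XsubC.
  by apply: contraNN zr; exact: mem_rem.
rewrite (dq w wr) (ql w wr) !hornerZ hornerM hornerXsubC.
by field; rewrite c0 zw lz0 lw0.
Qed.

End PartialFractions.

(** * The quadratic matrix polynomial z Phi(z) *)

Section PencilPolynomial.
Local Open Scope sesquilinear_scope.
Variables (C : numClosedFieldType) (d : nat) (A : 'M[C]_(d + d)).
Hypothesis Ah : A ^t* = A.

Let K : 'M[C]_d := ulsubmx A + drsubmx A.
Let B : 'M[C]_d := ursubmx A.
Let B' : 'M[C]_d := dlsubmx A.

(** Its determinant is [detPhi_poly A] by conversion; the name gives access to its adjugate. *)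
Definition pencil : 'M[{poly C}]_d :=
  'X *: map_mx polyC K + 'X^2 *: map_mx polyC B + map_mx polyC B'.

Lemma horner_pencil (z : C) :
  map_mx (horner_eval z) pencil = z *: K + z ^+ 2 *: B + B'.
Proof.
by apply/matrixP => i j; rewrite !mxE /= /horner_eval !hornerE.
Qed.

Lemma horner_pencilE (z : C) : z != 0 ->
  map_mx (horner_eval z) pencil = z *: Phi A z.
Proof.
move=> z0; rewrite horner_pencil /Phi -/K -/B -/B' !scalerDr !scalerA.
by rewrite mulfV // scale1r expr2.
Qed.

Lemma size_pencil i j : (size (pencil i j) <= 3)%N.
Proof.
rewrite !mxE (mulrC 'X) (mulrC 'X^2) !mul_polyC.
apply: (leq_trans (size_polyD _ _)); rewrite geq_max; apply/andP; split.
  apply: (leq_trans (size_polyD _ _)); rewrite geq_max; apply/andP; split.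
    by apply: (leq_trans (size_scale_leq _ _)); rewrite size_polyX.
  by apply: (leq_trans (size_scale_leq _ _)); rewrite size_polyXn.
by apply: (leq_trans (size_polyC_leq1 _)).
Qed.

(** Cofactors are minors of order d - 1 with quadratic entries, so of degree at most 2d - 2. With
    the factor ['X] the size just meets the bound of [partial_fractions] for 2d nodes. *)
Lemma size_adj_pencil i j : (0 < d)%N ->
  (size ('X * (\adj pencil) i j)%R <= d + d)%N.
Proof.
move=> d0; rewrite mxE /cofactor -signr_odd mulr_sign.
set p := \det _.
have sp : (size p <= (d.-1 * 2).+1)%N.
  by apply: size_det_leq => k l; rewrite 2!mxE; exact: size_pencil.
rewrite mulrC; apply: (leq_trans (size_polyMleq _ _)); rewrite size_polyX.
rewrite addn2 /= (fun_if (fun p : {poly C} => size p)) size_polyN if_same.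
apply: (leq_trans (n := (d.-1 * 2).+2)) => //.
by case: d d0 => // n _; rewrite /= muln2 -addnn addSn addnS.
Qed.

Lemma detPhi_polyX0 : (detPhi_poly A).[0] = \det B'.
Proof.
rewrite /detPhi_poly -horner_evalE -det_map_mx horner_pencil.
by rewrite expr0n /= !scale0r !add0r.
Qed.

Lemma ursubmx_adj : B ^t* = B'.
Proof. by rewrite /B' -[in RHS]Ah; apply/matrixP => i j; rewrite !mxE. Qed.

Lemma Phi_adj (z : C) : (Phi A z) ^t* = Phi A (z^*)^-1.
Proof.
apply/matrixP => i j.
have E k l : (A l k)^* = A k l by rewrite -[in RHS]Ah !mxE.
by rewrite !mxE !rmorphD /= !rmorphM /= !E fmorphV invrK; ring.
Qed.

End PencilPolynomial.

Lemma mem_mxker (C : numClosedFieldType) (d : nat) (M : 'M[C]_d) (x : 'cV[C]_d) :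
  (x \in mxker M) = (M *m x == 0).
Proof. by rewrite memv_ker lfunE. Qed.

(** * Roots of the determinant and the adjugate at a root *)

Section Roots.
Local Open Scope sesquilinear_scope.
Variables (C : numClosedFieldType) (d : nat) (A : 'M[C]_(d + d)).
Variable u : C -> 'cV[C]_d.
Hypothesis Ah : A ^t* = A.
Hypothesis A1 : assumption_I A.
Hypothesis ker_u : spanning_kernels A u.

Let K : 'M[C]_d := ulsubmx A + drsubmx A.
Let B : 'M[C]_d := ursubmx A.
Let B' : 'M[C]_d := dlsubmx A.

Lemma Sset_conjV w : Sset A w -> Sset A (w^*)^-1.
Proof.
move=> [w0 dw]; split; first by rewrite invr_eq0 conjC_eq0.
by rewrite -Phi_adj // det_map_mx det_tr dw rmorph0.
Qed.

Lemma ker_Phi w x : Sset A w -> Phi A w *m x = 0 -> exists k, x = k *: u w.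
Proof.
move=> Sw xw; have [_ kw] := ker_u Sw.
by apply/vlineP; rewrite kw mem_mxker xw.
Qed.

Lemma Phi_mul_u w : Sset A w -> Phi A w *m u w = 0.
Proof.
move=> Sw; have [_ kw] := ker_u Sw.
by apply/eqP; rewrite -mem_mxker -kw memv_line.
Qed.

(** This characteristic equation makes [w ^+ n *: u w] a solution of the recurrence in
    [decaying_solution_eq0]. *)
Lemma quadratic_mul_u w : Sset A w ->
  dlsubmx A *m u w + w *: ((ulsubmx A + drsubmx A) *m u w)
    + w ^+ 2 *: (ursubmx A *m u w) = 0.
Proof.
move=> Sw; have [w0 _] := Sw.
have := Phi_mul_u Sw => /(congr1 (fun x => w *: x)).
rewrite scaler0 scalemxAl -horner_pencilE // horner_pencil !mulmxDl -!scalemxAl.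
by move=> <-; rewrite [RHS]addrC addrA mulmxDl.
Qed.

Lemma lker_Phi w (y : 'rV[C]_d) : Sset A w -> y *m Phi A w = 0 ->
  exists k, y = k *: (u (w^*)^-1) ^t*.
Proof.
move=> Sw yw.
have [|k yk] := @ker_Phi _ (y ^t*) (Sset_conjV Sw).
  by rewrite -Phi_adj // -map_mxM -trmx_mul yw trmx0 map_mx0.
exists k^*; apply/matrixP => i j; have := congr1 (fun M : 'cV_d => (M j i)^*) yk.
by rewrite !mxE conjCK rmorphM.
Qed.

Lemma detPhi_poly_coef_top : (detPhi_poly A)`_(d * 2) = \det B.
Proof.
rewrite -[detPhi_poly A]/(\det (pencil A)) coef_det_top; last exact: size_pencil.
congr (\det _); apply/matrixP => i j.
by rewrite !mxE !coefD coefXM coefXnM !coefC /= add0r addr0.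
Qed.

Lemma det_ursubmx_neq0 : \det B != 0.
Proof. by rewrite -unitfE -unitmxE -row_free_unit /row_free A1. Qed.

Lemma det_dlsubmx_neq0 : \det B' != 0.
Proof.
by rewrite /B' -ursubmx_adj // det_map_mx det_tr conjC_eq0 det_ursubmx_neq0.
Qed.

Lemma size_detPhi_poly : size (detPhi_poly A) = (d * 2).+1.
Proof.
apply/eqP; rewrite eqn_leq (size_det_leq (@size_pencil _ _ A)) /= ltnNge.
apply/negP => /(nth_default 0)/eqP; apply/negP.
by rewrite detPhi_poly_coef_top det_ursubmx_neq0.
Qed.

(** The point 0, excluded from [Sset A], is no root: the value there is [\det B'], and [B'] is the
    adjoint of the invertible [B]. *)
Lemma root_detPhi_poly w : root (detPhi_poly A) w <-> Sset A w.
Proof.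
split=> [|[w0 dw]]; last by rewrite /root detPhi_polyE // dw mulr0.
rewrite /root; have [->|w0] := eqVneq w 0.
  by rewrite detPhi_polyX0 (negPf det_dlsubmx_neq0).
by rewrite detPhi_polyE // mulf_eq0 expf_eq0 (negPf w0) andbF => /eqP.
Qed.

Lemma adj_pencil_root w : Sset A w ->
  exists2 c, map_mx (horner_eval w) (\adj (pencil A)) = c *: Pmx u w
    & c * (w * inner (u (w^*)^-1) (dPhi A w *m u w)) = (detPhi_poly A)^`().[w].
Proof.
move=> Sw; have [w0 dw] := Sw; have [u0 _] := ker_u Sw.
set M := map_mx _ _.
have qw : (detPhi_poly A).[w] = 0 by apply/eqP/root_detPhi_poly.
have MP : M *m Phi A w = 0.
  apply: (scalerI w0); rewrite scaler0 scalemxAr -horner_pencilE // -map_mxM.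
  by rewrite mul_adj_mx map_scalar_mx /= /horner_eval qw raddf0.
have PM : Phi A w *m M = 0.
  apply: (scalerI w0); rewrite scaler0 scalemxAl -horner_pencilE // -map_mxM.
  by rewrite mul_mx_adj map_scalar_mx /= /horner_eval qw raddf0.
have /choice[kk kkE] j : exists k, col j M = k *: u w.
  by apply: ker_Phi => //; rewrite colE mulmxA PM mul0mx.
have ME : M = u w *m \row_j kk j.
  apply/matrixP => i j; rewrite !mxE big_ord1 !mxE mulrC.
  by have := congr1 (fun X : 'cV_d => X i 0) (kkE j); rewrite !mxE.
(* The identity [M *m Phi A w = 0] passes to the row factor of [M] because some entry of [u w] is
   nonzero. *)
have [c cE] : exists c, \row_j kk j = c *: (u (w^*)^-1) ^t*.
  apply: lker_Phi => //; apply/matrixP => i j.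
  have /cV0Pn[i0 ui0] := u0.
  have := congr1 (fun X : 'M[C]_d => X i0 j) MP.
  rewrite ME -mulmxA mxE big_ord1 (ord1 i) [RHS]mxE => /eqP.
  by rewrite mulf_eq0 (negPf ui0) /= => /eqP ->; rewrite mxE.
have McP : M = c *: Pmx u w by rewrite ME cE -scalemxAr.
exists c => //.
have wq : ('X - w%:P) %| detPhi_poly A by rewrite dvdp_XsubCl; apply/root_detPhi_poly.
have [l ql] := dvdpP _ _ wq.
have dq : (detPhi_poly A)^`().[w] = l.[w].
  by rewrite ql derivM derivXsubC mulr1 hornerD hornerM hornerXsubC subrr mulr0 add0r.
pose up := map_mx polyC (u w).
(* [G] is the quotient of [pencil A *m up] by ['X - w%:P]: eliminating [B' *m u w] leaves (X - w) K
   u + (X^2 - w^2) B u. *)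
pose G := ('X + w%:P) *: map_mx polyC (B *m u w) + map_mx polyC (K *m u w).
have b'E : B' *m u w = - (w *: (K *m u w) + w ^+ 2 *: (B *m u w)).
  by apply/eqP; rewrite -addr_eq0 addrA quadratic_mul_u.
(* Since [pencil A] kills [u w] at [w], ['X - w%:P] divides [pencil A *m up];
   cancelling it in [\adj Q *m (Q *m up) = \det Q *: up] and evaluating at [w]
   gives [c] without differentiating the determinant. *)
have pu : pencil A *m up = ('X - w%:P) *: G.
  rewrite /pencil !mulmxDl -!scalemxAl -!map_mxM -/K -/B -/B' b'E /G.
  move: (B *m u w) (K *m u w) => b k.
  apply/matrixP => i j; rewrite !mxE !(rmorphN, rmorphD, rmorphM) /=.
  by ring.
have Gw : map_mx (horner_eval w) G = w *: (dPhi A w *m u w).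
  rewrite dPhiE // mulmxBl -scalemxAl -/B -/B' b'E /G.
  move: (B *m u w) (K *m u w) => b k.
  apply/matrixP => i j; rewrite !mxE /horner_eval !hornerE.
  by field.
have : M *m map_mx (horner_eval w) G = l.[w] *: u w.
  have -> : l.[w] *: u w = map_mx (horner_eval w) (l *: up).
    by apply/matrixP => i j; rewrite !mxE /horner_eval hornerM hornerC.
  rewrite -map_mxM; congr map_mx; apply/matrixP => i j.
  apply: (@mulfI _ ('X - w%:P)); first by rewrite polyXsubC_eq0.
  have := congr1 (fun X : 'cV_d => X i j) (mulmxA (\adj (pencil A)) (pencil A) up).
  rewrite mul_adj_mx mul_scalar_mx pu -scalemxAr -[\det _]/(detPhi_poly A) ql.
  by rewrite mxE => ->; rewrite !mxE mulrA (mulrC l).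
rewrite Gw McP -scalemxAr -scalemxAl Pmx_mul !scalerA => /eqP.
rewrite -subr_eq0 -scalerBl scaler_eq0 (negPf u0) orbF subr_eq0 dq => /eqP <-.
by ring.
Qed.

End Roots.

(** * Partial fractions of the inverse symbol *)

Section PartialFractionsOfInverse.
Local Open Scope sesquilinear_scope.
Variables (C : numClosedFieldType) (d : nat) (A : 'M[C]_(d + d)).
Variable u : C -> 'cV[C]_d.
Hypothesis Ah : A ^t* = A.
Hypothesis A1 : assumption_I A.
Hypothesis A2 : assumption_II A.
Hypothesis ker_u : spanning_kernels A u.

Lemma detPhi_poly_factor : exists c (r : seq C),
  [/\ detPhi_poly A = c *: \prod_(w <- r) ('X - w%:P), c != 0, uniq r,
      size r = (d * 2)%N & Sset A = [set` r]].
Proof.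
have [r qE] := closed_field_poly_normal (detPhi_poly A).
set c := lead_coef _ in qE.
have q0 : detPhi_poly A != 0 by rewrite -size_poly_gt0 size_detPhi_poly.
have c0 : c != 0 by rewrite lead_coef_eq0.
have rS w : w \in r <-> Sset A w.
  by rewrite -root_detPhi_poly // qE rootZ // root_prod_XsubC.
exists c, r; split => //.
(* [r] lists roots with repetition, so counting [w] in [r] gives its multiplicity, which Assumption
   II makes 1. *)
- apply: count_mem_uniq => w; case: (boolP (w \in r)) => [wr|]; last first.
    by move/count_memPn.
  have /A2[+ _] : Sset A w by apply/rS.
  rewrite {1}qE -mul_polyC mupMr ?mu_prod_XsubC //.
  by rewrite rootC.
- have := size_detPhi_poly A1.
  by rewrite qE size_scale // size_prod_XsubC => -[].
- by apply/seteqP; split => w /= /rS.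
Qed.

Lemma deriv_detPhi_poly_neq0 w : Sset A w -> (detPhi_poly A)^`().[w] != 0.
Proof.
have [c [r [-> c0 ur _ ->]]] := detPhi_poly_factor.
exact: deriv_prod_XsubC_neq0.
Qed.

Lemma inner_dPhi_neq0 w : Sset A w ->
  inner (u (w^*)^-1) (dPhi A w *m u w) != 0.
Proof.
move=> Sw; have [c _ cE] := adj_pencil_root Ah A1 ker_u Sw.
apply: contraNneq (deriv_detPhi_poly_neq0 Sw) => w0.
by rewrite -cE w0 !mulr0.
Qed.

(** The residue at [w]: the factor [w] coming from ['X] cancels the one in the second equation of
    [adj_pencil_root]. *)
Lemma adj_pencil_alpha w i j : Sset A w ->
  ('X * (\adj (pencil A)) i j).[w] / (detPhi_poly A)^`().[w] =
  alpha A u w * Pmx u w i j.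
Proof.
move=> Sw; have [c cP cE] := adj_pencil_root Ah A1 ker_u Sw.
have [w0 _] := Sw; have I0 := inner_dPhi_neq0 Sw.
have c0 : c != 0.
  apply: contraNneq (deriv_detPhi_poly_neq0 Sw) => c0.
  by rewrite -cE c0 mul0r.
have := congr1 (fun M : 'M[C]_d => M i j) cP.
rewrite mxE /horner_eval [RHS]mxE hornerM hornerX => ->.
by rewrite -cE /alpha; field; rewrite c0 w0 I0.
Qed.

Lemma invmx_PhiE z : z != 0 -> ~ Sset A z ->
  invmx (Phi A z) = (z / (detPhi_poly A).[z]) *:
    map_mx (horner_eval z) (\adj (pencil A)).
Proof.
move=> z0 nSz; have dz : \det (Phi A z) != 0 by apply/eqP => dz; apply: nSz.
have qz : (detPhi_poly A).[z] != 0.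
  by rewrite detPhi_polyE // mulf_neq0 // expf_neq0.
have PU : Phi A z \in unitmx by rewrite unitmxE unitfE.
rewrite -[LHS]mulmx1 -[RHS](mulKmx PU); congr (_ *m _).
rewrite [z / _]mulrC -scalerA -!scalemxAr scalemxAl.
rewrite -horner_pencilE // -map_mxM mul_mx_adj map_scalar_mx /= /horner_eval.
by rewrite scale_scalar_mx mulVf.
Qed.

Lemma invmx_Phi_sum z : (0 < d)%N -> z != 0 -> ~ Sset A z ->
  invmx (Phi A z) =
    \sum_(w \in Sset A) (alpha A u w / (z - w)) *: Pmx u w.
Proof.
move=> d0 z0 nSz; rewrite invmx_PhiE //.
have [c [r [qE c0 ur sr SE]]] := detPhi_poly_factor.
have Sr w : w \in r -> Sset A w by rewrite SE.
have zr : z \notin r by apply/negP => /Sr.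
rewrite SE -fsbig_seq //; apply/matrixP => i j.
rewrite summxE mxE [X in _ * X]mxE /horner_eval.
have := partial_fractions (p := 'X * (\adj (pencil A)) i j) qE c0 ur _ zr.
rewrite sr muln2 -addnn => /(_ (size_adj_pencil _ _ _ d0)).
rewrite hornerM hornerX mulrAC => ->.
rewrite big_seq [RHS]big_seq; apply: eq_bigr => w /Sr Sw.
by rewrite adj_pencil_alpha // [RHS]mxE mulrAC.
Qed.

Lemma finite_Sset : finite_set (Sset A).
Proof.
by have [c [r [_ _ _ _ ->]]] := detPhi_poly_factor; exact: finite_seq.
Qed.

End PartialFractionsOfInverse.

(** * Linear independence of finite families *)

Section FreeFamilies.
Variables (F : fieldType) (V : vectType F) (I : eqType).

Lemma free_map (f : I -> V) (s : seq I) : uniq s ->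
  (forall c : I -> F, \sum_(i <- s) c i *: f i = 0 ->
     forall i, i \in s -> c i = 0) ->
  free (map f s).
Proof.
move=> us indep; apply/(@freeP _ _ _ (in_tuple (map f s))) => k k0 i.
case: s us indep k k0 i => [|x0 s] us indep k k0 i; first by case: i.
set s' := x0 :: s in us indep k k0 i *.
(* Transports [k] from positions to elements, unambiguously as [s'] is duplicate-free; the default 0
   is taken only outside [s']. *)
pose c x := if insub (index x s') is Some j then k j else 0.
have si : (i < size s')%N by rewrite -(size_map f).
have cE (j : 'I_(size (map f s'))) : c (nth x0 s' j) = k j.
  have sj : (j < size s')%N by rewrite -(size_map f).
  by rewrite /c index_uniq // valK.
rewrite -cE; apply: indep; last exact: mem_nth.
rewrite -[RHS]k0 (big_nth x0) -(size_map f) big_mkord.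
apply: eq_bigr => j _; rewrite cE (nth_map x0) //.
by rewrite -(size_map f).
Qed.

End FreeFamilies.

(** By linearity the relations for powers extend to all polynomials; one vanishing on [s] except at
    [w] isolates [v w]. *)
Lemma vandermonde_eq0 (F : fieldType) (V : lmodType F) (s : seq F) (v : F -> V) :
  uniq s -> (forall n, \sum_(w <- s) w ^+ n *: v w = 0) ->
  forall w, w \in s -> v w = 0.
Proof.
move=> us v0 w ws; pose p := \prod_(x <- rem w s) ('X - x%:P).
have : \sum_(x <- s) p.[x] *: v x = 0.
  under eq_bigr do rewrite horner_coef scaler_suml.
  rewrite exchange_big big1 // => i _ /=.
  under eq_bigr do rewrite -scalerA.
  by rewrite -scaler_sumr v0 scaler0.
rewrite (bigD1_seq w) //= big1_seq ?addr0 => [/eqP|x /andP[xw xs]].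
  rewrite scaler_eq0 => /orP[|/eqP //].
  by rewrite -[_ == 0]/(root _ _) root_prod_XsubC mem_rem_uniq // inE /= eqxx.
suff /eqP -> : root p x by rewrite scale0r.
by rewrite root_prod_XsubC mem_rem_uniq // inE /= xw.
Qed.

(** Both [e] and the modulus are real, so real geometric sequences suffice. The energy argument
    takes this decay as the hypothesis [expr_small], since a [numClosedFieldType] need not be
    Archimedean. *)
Lemma near_expr_norm_lt (R : realType) (z e : R[i]) : `|z| < 1 -> 0 < e ->
  \forall n \near \oo, `|z| ^+ n < e.
Proof.
move=> z1 e0.
have eE : e = ((complex.Re e)%:C)%C by rewrite RRe_real // gtr0_real.
pose r : R := Normc.normc z.
have zr : `|z| = (r%:C)%C by [].
have r0 : 0 <= r by rewrite -lecR -zr; exact: normr_ge0.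
have r1 : `|r| < 1 by rewrite ger0_norm // -ltcR -zr.
have e'0 : 0 < complex.Re e by rewrite -ltcR -eE.
have := cvg_expr r1 => /cvgr0Pnorm_lt /(_ _ e'0).
apply: filterS => n; rewrite ger0_norm ?exprn_ge0 // => rn.
by rewrite zr eE -rmorphXn ltcR.
Qed.

Lemma innerDr (C : numClosedFieldType) (d : nat) (x y z : 'cV[C]_d) :
  inner x (y + z) = inner x y + inner x z.
Proof. by rewrite /inner mulmxDr mxE. Qed.

Lemma innerNr (C : numClosedFieldType) (d : nat) (x y : 'cV[C]_d) :
  inner x (- y) = - inner x y.
Proof. by rewrite /inner mulmxN mxE. Qed.

Lemma innerE (C : numClosedFieldType) (d : nat) (x y : 'cV[C]_d) :
  inner x y = \sum_i (x i 0)^* * y i 0.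
Proof. by rewrite /inner mxE; apply: eq_bigr => i _; rewrite !mxE. Qed.

Lemma inner_col_mx (C : numClosedFieldType) (d : nat) (x y z t : 'cV[C]_d) :
  inner (col_mx x y) (col_mx z t) = inner x z + inner y t.
Proof.
rewrite !innerE big_split_ord /=.
by congr (_ + _); apply: eq_bigr => i _; rewrite ?col_mxEu ?col_mxEd.
Qed.

Lemma cvg_sum0 (K : numFieldType) (T I : Type) (F : set_system T)
    (r : seq I) (P : pred I) (f : I -> T -> K) : Filter F ->
  (forall i, P i -> f i x @[x --> F] --> (0 : K)) ->
  \sum_(i <- r | P i) f i x @[x --> F] --> (0 : K).
Proof.
move=> FF f0.
rewrite -[X in _ --> X](_ : \sum_(i <- r | P i) (0 : K) = 0); last by rewrite big1.
by apply: cvg_big => //; exact: add_continuous.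
Qed.

(** * Energy argument for decaying solutions of the recurrence *)

Section Energy.
Variables (C : numClosedFieldType) (d : nat) (a b b' a' : 'M[C]_d).
Hypothesis expr_small : forall z e : C, `|z| < 1 -> 0 < e ->
  \forall n \near \oo, `|z| ^+ n < e.
Hypothesis form_gt0 : forall x y : 'cV[C]_d, (x != 0) || (y != 0) ->
  0 < inner x (a *m x + b *m y) + inner y (b' *m x + a' *m y).

Lemma cvg_expr0 (z : C) : `|z| < 1 -> z ^+ n @[n --> \oo] --> (0 : C).
Proof.
move=> z1; apply/cvgr0Pnorm_lt => e e0.
by apply: filterS (expr_small z1 e0) => n; rewrite normrX.
Qed.

Lemma cvg_mulmx0 (M : 'M[C]_d) (x : nat -> 'cV[C]_d) :
  (forall i, x n i 0 @[n --> \oo] --> (0 : C)) ->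
  forall i, (M *m x n) i 0 @[n --> \oo] --> (0 : C).
Proof.
move=> x0 i; rewrite (_ : (fun n => _) = (fun n => \sum_j M i j * x n j 0)).
  apply: cvg_sum0 => j _; rewrite -[X in _ --> X](mulr0 (M i j)).
  exact: cvgMl_tmp.
by apply/funext => n; rewrite mxE.
Qed.

Lemma cvg_inner0 (x y : nat -> 'cV[C]_d) :
  (forall i, x n i 0 @[n --> \oo] --> (0 : C)) ->
  (forall i, y n i 0 @[n --> \oo] --> (0 : C)) ->
  inner (x n) (y n) @[n --> \oo] --> (0 : C).
Proof.
move=> x0 y0; rewrite (_ : (fun n => _) = (fun n => \sum_i (x n i 0)^* * y n i 0)).
  apply: cvg_sum0 => i _; rewrite -[X in _ --> X](mulr0 (0 : C)).
  apply: cvgM => //; apply/cvgr0Pnorm_lt => e e0.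
  have /cvgr0Pnorm_lt/(_ _ e0) := x0 i.
  by apply: filterS => n; rewrite norm_conjC.
by apply/funext => n; rewrite innerE.
Qed.

(** The blocks [a], [b], [b'], [a'] of the positive form stay abstract so as to serve both [A] and
    its version with L and R exchanged. *)
Lemma decaying_solution_eq0 (X : nat -> 'cV[C]_d) :
  X 0 = 0 ->
  (forall i, X n i 0 @[n --> \oo] --> (0 : C)) ->
  (forall n, b' *m X n + (a + a') *m X n.+1 + b *m X n.+2 = 0) ->
  forall n, X n = 0.
Proof.
move=> X0 cX rec.
(* [E n] is the form at (X n, X n.+1) and [h n] its second half, the boundary term; [h n] turns out
   to be the sum of the energies up to [n]. *)
pose h n := inner (X n.+1) (b' *m X n + a' *m X n.+1).
pose E n := inner (X n) (a *m X n + b *m X n.+1) + h n.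
have E_ge0 n : 0 <= E n.
  have [|] := boolP ((X n != 0) || (X n.+1 != 0)) => [/form_gt0/ltW //|].
  rewrite negb_or !negbK => /andP[/eqP n0 /eqP n1].
  by rewrite /E /h n0 n1 !mulmx0 addr0 innerE big1 ?addr0 // => i; rewrite !mxE mulr0.
(* By the recurrence the energies [E] telescope: [E n.+1] is an increment of [h]. *)
have hE n : h n.+1 = h n + E n.+1.
  rewrite /E [X in X + h _](_ : _ = - h n); first by rewrite addrA subrr add0r.
  rewrite /h -innerNr; congr inner; apply/eqP; rewrite -addr_eq0 -(rec n).
  by rewrite mulmxDl; apply/eqP/matrixP => i j; rewrite !mxE; ring.
(* The condition [X 0 = 0] removes the boundary term at the start. *)
have h0E : h 0 = E 0.
  rewrite /E X0 [inner 0 _](_ : _ = 0) ?add0r // innerE big1 // => i _.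
  by rewrite !mxE conjC0 mul0r.
have h_ge0 n : 0 <= h n by elim: n => [|n IH]; rewrite ?h0E // hE addr_ge0.
have h_ndecr m n : h m <= h (m + n)%N.
  elim: n => [|n IH]; rewrite ?addn0 // addnS hE.
  by apply: (le_trans IH); rewrite lerDl.
have cXS i : X n.+1 i 0 @[n --> \oo] --> (0 : C).
  by rewrite (cvg_shiftS (fun n => X n i 0)).
have ch : h n @[n --> \oo] --> (0 : C).
  apply: cvg_inner0 => // i.
  rewrite (_ : (fun n => _) =
      (fun n => (b' *m X n) i 0 + (a' *m X n.+1) i 0)).
    rewrite -[X in _ --> X](addr0 (0 : C)).
    by apply: cvgD; apply: cvg_mulmx0.
  by apply/funext => n; rewrite !mxE.
(* A positive [h n] would bound all later values from below, against [ch]. *)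
have h0 n : h n = 0.
  apply/eqP; rewrite eq_le h_ge0 andbT; apply: contraT => hn.
  have hn0 : 0 < h n.
    by rewrite lt_neqAle h_ge0 andbT eq_sym; apply: contraNneq hn => ->.
  have [m [mn hm]] : exists m, (n <= m)%N /\ `|h m| < h n.
    have /cvgr0Pnorm_lt/(_ _ hn0) hlt := ch.
    have [m [mn hm]] := filter_ex (filterI (nbhs_infty_ge n) hlt).
    by exists m.
  have := h_ndecr n (m - n)%N; rewrite subnKC // => /le_lt_trans.
  move: hm; rewrite ger0_norm // => hm /(_ _ hm); by rewrite ltxx.
have E0 n : E n = 0.
  case: n => [|n]; first by rewrite -h0E.
  by have := hE n; rewrite !h0 add0r.
move=> n; apply/eqP; apply: contraT => Xn.
have := form_gt0 (x := X n) (y := X n.+1).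
by rewrite Xn -/(h n) -/(E n) E0 ltxx => /(_ isT).
Qed.

Lemma decaying_modes_indep (s : seq C) (u : C -> 'cV[C]_d) (c : C -> C) :
  uniq s -> (forall w, w \in s -> `|w| < 1) ->
  (forall w, w \in s -> u w != 0) ->
  (forall w, w \in s -> b' *m u w + w *: ((a + a') *m u w) + w ^+ 2 *: (b *m u w) = 0) ->
  \sum_(w <- s) c w *: u w = 0 -> forall w, w \in s -> c w = 0.
Proof.
move=> us s1 u0 Qu cu w ws.
pose X n := \sum_(w <- s) w ^+ n *: (c w *: u w).
suff X0 : forall n, X n = 0.
  have /eqP := vandermonde_eq0 us X0 ws.
  by rewrite scaler_eq0 (negPf (u0 _ ws)) orbF => /eqP.
apply: decaying_solution_eq0.
- by rewrite /X -[RHS]cu; apply: eq_bigr => x _; rewrite expr0 scale1r.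
- move=> i; rewrite (_ : (fun n => _) =
      (fun n => \sum_(x <- s | x \in s) x ^+ n * (c x *: u x) i 0)).
      apply: cvg_sum0 => x xs; rewrite -[X in _ --> X](mul0r ((c x *: u x) i 0)).
    by apply: cvgMr_tmp; apply: cvg_expr0; exact: s1.
  apply/funext => n; rewrite summxE big_seq; apply: eq_bigr => x _.
  by rewrite mxE.
move=> n; rewrite /X !mulmx_sumr -!big_split /= big1_seq // => x xs.
rewrite -!scalemxAr -[RHS](scaler0 _ (x ^+ n)) -[X in _ = _ *: X](scaler0 _ (c x)).
rewrite -(Qu x xs) !scalerDr !scalerA !exprS expr0.
by congr (_ *: _ + _ *: _ + _ *: _); ring.
Qed.

End Energy.

Lemma innerZl (C : numClosedFieldType) (d : nat) (k : C) (x y : 'cV[C]_d) :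
  inner (k *: x) y = k^* * inner x y.
Proof.
rewrite !innerE mulr_sumr; apply: eq_bigr => i _.
by rewrite mxE rmorphM mulrA.
Qed.

Lemma innerZr (C : numClosedFieldType) (d : nat) (k : C) (x y : 'cV[C]_d) :
  inner x (k *: y) = k * inner x y.
Proof. by rewrite /inner -scalemxAr mxE. Qed.

(** * Location of the roots and the two bases *)

Section Bases.
Local Open Scope sesquilinear_scope.
Variables (C : numClosedFieldType) (d : nat) (A : 'M[C]_(d + d)).
Variable u : C -> 'cV[C]_d.
Hypothesis expr_small : forall z e : C, `|z| < 1 -> 0 < e ->
  \forall n \near \oo, `|z| ^+ n < e.
Hypothesis Apos : hermitian_posdef A.
Hypothesis A1 : assumption_I A.
Hypothesis A2 : assumption_II A.
Hypothesis ker_u : spanning_kernels A u.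

Let Ah : A ^t* = A := Apos.1.

Lemma posdef_block (x y : 'cV[C]_d) : (x != 0) || (y != 0) ->
  0 < inner x (ulsubmx A *m x + ursubmx A *m y)
    + inner y (dlsubmx A *m x + drsubmx A *m y).
Proof.
move=> xy; rewrite -inner_col_mx -mul_block_col submxK; apply: Apos.2.
by rewrite col_mx_eq0 negb_and.
Qed.

(** On the unit circle [w^*] is [w^-1], so <u, Phi(w) u> is the positive form of [A] at (u, w u),
    whereas Phi(w) u = 0. *)
Lemma Sset_norm_neq1 w : Sset A w -> `|w| != 1.
Proof.
move=> Sw; have [w0 _] := Sw; have [u0 _] := ker_u Sw.
apply/eqP => w1; have wV : w^* = w^-1 by rewrite invC_norm w1 expr1n invr1 mul1r.
have := @posdef_block (u w) (w *: u w); rewrite u0 => /(_ isT).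
rewrite innerZl wV -innerZr -innerDr [X in inner _ X](_ : _ = Phi A w *m u w).
  by rewrite Phi_mul_u // innerE big1 ?ltxx // => i _; rewrite mxE mulr0.
rewrite /Phi !mulmxDl -!scalemxAl -!scalemxAr scalerDr scalerA mulVf // scale1r.
by rewrite -!addrA; congr (_ + _); rewrite [LHS]addrA [LHS]addrC.
Qed.

Lemma Sset_lt1U : Sset A = Sset_lt1 A `|` Sset_gt1 A.
Proof.
apply/seteqP; split=> [w Sw|w [[]|[]]] //.
have := Sset_norm_neq1 Sw.
by case: (real_ltgtP (normr_real w) (real1 C)) => w1 // _; [left|right].
Qed.

Lemma Sset_lt1I : Sset_lt1 A `&` Sset_gt1 A = set0.
Proof. by apply/seteqP; split=> // w [[_ w1] [_ /(lt_trans w1)]]; rewrite ltxx. Qed.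

Lemma finite_Sset_lt1 : finite_set (Sset_lt1 A).
Proof.
by apply: sub_finite_set (finite_Sset Ah A1 A2) => w [].
Qed.

Lemma finite_Sset_gt1 : finite_set (Sset_gt1 A).
Proof.
by apply: sub_finite_set (finite_Sset Ah A1 A2) => w [].
Qed.

Lemma set_bij_conjV : set_bij (Sset_lt1 A) (Sset_gt1 A) (fun w => (w^*)^-1).
Proof.
split.
- move=> w [Sw w1]; split; first exact: Sset_conjV.
  by have [w0 _] := Sw; rewrite normfV norm_conjC invf_gt1 // normr_gt0.
- by move=> x y _ _ /invr_inj /(can_inj conjCK).
move=> w [Sw w1]; exists (w^*)^-1; last by rewrite fmorphV invrK /= conjCK.
split; first exact: Sset_conjV.
by have [w0 _] := Sw; rewrite normfV norm_conjC invf_lt1 // normr_gt0.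
Qed.

(** The part over |w| > 1 is reindexed by the reflection [set_bij_conjV]. *)
Lemma sum_Sset_lt1 (V : nmodType) (f : C -> V) :
  \sum_(w \in Sset A) f w = \sum_(w \in Sset_lt1 A) (f w + f (w^*)^-1).
Proof.
rewrite Sset_lt1U fsbigU; [|exact: finite_Sset_lt1|exact: finite_Sset_gt1|].
  rewrite fsbig_split; last exact: finite_Sset_lt1.
  by rewrite (reindex_fsbig _ _ _ _ set_bij_conjV).
by rewrite Sset_lt1I.
Qed.

Lemma free_u_lt1 (s : seq C) : uniq s -> (forall w, w \in s -> Sset_lt1 A w) ->
  free (map u s).
Proof.
move=> us sS; apply: free_map => // c.
apply: (decaying_modes_indep expr_small posdef_block) => // w /sS[Sw w1] //.
  by have [] := ker_u Sw.
exact: quadratic_mul_u.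
Qed.

Lemma free_u_gt1 (s : seq C) : uniq s -> (forall w, w \in s -> Sset_gt1 A w) ->
  free (map u s).
Proof.
move=> us sS; apply: free_map => // c cu w ws.
(* Exchanging the L and R blocks turns [w] into [w^-1] in the symbol. *)
have form_gt0 (x y : 'cV[C]_d) : (x != 0) || (y != 0) ->
    0 < inner x (drsubmx A *m x + dlsubmx A *m y)
      + inner y (ursubmx A *m x + ulsubmx A *m y).
  move=> xy; rewrite addrC (addrC (drsubmx A *m x)) (addrC (ursubmx A *m x)).
  by apply: posdef_block; rewrite orbC.
have Ss v : v \in map GRing.inv s -> Sset_gt1 A v^-1.
  by move=> /mapP[x xs ->]; rewrite invrK; exact: sS.
have := @decaying_modes_indep _ _ _ _ _ _ expr_small form_gt0
  (map GRing.inv s) (u \o GRing.inv) (c \o GRing.inv) _ _ _ _ _ w^-1.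
rewrite /= invrK map_f //; apply => //.
- by rewrite map_inj_uniq //; exact: invr_inj.
- move=> v /Ss[[v0 _]]; rewrite normfV => v1.
  by rewrite -invf_gt1 // normr_gt0 -invr_eq0.
- by move=> v /Ss[/ker_u[]].
- move=> v /Ss[Sv _]; have [v0 _] := Sv; rewrite invr_eq0 in v0.
  (* Multiplying the equation at [v^-1] by [v ^+ 2] reverses the order of its coefficients. *)
  have := quadratic_mul_u ker_u Sv => /(congr1 (fun x => v ^+ 2 *: x)).
  rewrite scaler0 !scalerDr !scalerA => <-.
  rewrite -!exprMn mulfV // expr1n scale1r expr2 mulfK // (addrC (ulsubmx A)).
  by rewrite [LHS]addrC [RHS]addrAC -[RHS]addrA.
- by rewrite big_map -[RHS]cu; apply: eq_bigr => x _; rewrite invrK.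
Qed.

Lemma free_size_leq (s : seq 'cV[C]_d) : free s -> (size s <= d)%N.
Proof.
move=> /eqP <-; apply: (leq_trans (dimvS (subvf _))).
by rewrite dimvf /dim /= muln1.
Qed.

Lemma bases_lt1_gt1 : is_basis_on (Sset_lt1 A) u /\ is_basis_on (Sset_gt1 A) u.
Proof.
rewrite /is_basis_on.
set s := finmap.enum_fset (fset_set (Sset_lt1 A)).
set t := finmap.enum_fset (fset_set (Sset_gt1 A)).
have sE w : (w \in s) = (w \in Sset_lt1 A).
  exact: (in_fset_set finite_Sset_lt1).
have tE w : (w \in t) = (w \in Sset_gt1 A).
  exact: (in_fset_set finite_Sset_gt1).
have us : uniq s := finmap.fset_uniq _.
have ut : uniq t := finmap.fset_uniq _.
have fs : free (map u s) by apply: free_u_lt1 => // w; rewrite sE inE.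
have ft : free (map u t) by apply: free_u_gt1 => // w; rewrite tE inE.
have [c [r [_ _ ur sr SE]]] := detPhi_poly_factor Ah A1 A2.
have : perm_eq (s ++ t) r.
  apply: uniq_perm => // [|w].
    rewrite cat_uniq us ut andbT /=; apply/hasPn => w; rewrite tE inE => wt.
    apply/negP; rewrite sE inE => ws.
    by have : (Sset_lt1 A `&` Sset_gt1 A) w by []; rewrite Sset_lt1I.
  rewrite mem_cat sE tE -in_setU -Sset_lt1U SE.
  by apply/idP/idP; rewrite inE.
move=> /perm_size; rewrite size_cat sr => st.
have := free_size_leq fs; have := free_size_leq ft; rewrite !size_map => td sd.
have dimd : \dim (fullv : {vspace 'cV[C]_d}) = d by rewrite dimvf /dim /= muln1.
rewrite !basisEfree fs ft !subvf !size_map dimd /=.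
(* As the sizes of [s] and [t] add up to 2d, the upper bound [d] on one gives the lower bound [d] on
   the other. *)
by split; [rewrite -(leq_add2r (size t)) | rewrite -(leq_add2l (size s))];
  rewrite st muln2 -addnn ?leq_add2l ?leq_add2r.
Qed.

End Bases.

Theorem theorem2p1 (R : realType) (d : nat) (A : 'M[R[i]]_(d + d))
    (u : R[i] -> 'cV[R[i]]_d) :
  (1 <= d)%N ->
  hermitian_posdef A ->
  assumption_I A ->
  assumption_II A ->
  spanning_kernels A u ->
  [/\ forall w, Sset A w -> inner (u (w^*)^-1) (dPhi A w *m u w) != 0,
      forall z, z != 0 -> ~ Sset A z ->
        invmx (Phi A z) =
          \sum_(w \in Sset A) (alpha A u w / (z - w)) *: Pmx u w
        /\
        \sum_(w \in Sset A) (alpha A u w / (z - w)) *: Pmx u w =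
          \sum_(w \in Sset_lt1 A)
            ((alpha A u w / (z - w)) *: Pmx u w
             + (alpha A u (w^*)^-1 / (z - (w^*)^-1)) *: Pmx u (w^*)^-1),
      is_basis_on (Sset_lt1 A) u
    & is_basis_on (Sset_gt1 A) u].
Proof.
move=> d0 Apos A1 A2 ker_u.
have small := @near_expr_norm_lt R.
have [Blt Bgt] := bases_lt1_gt1 small Apos A1 A2 ker_u.
split=> // [w Sw|z z0 nSz]; first exact: (inner_dPhi_neq0 Apos.1).
split; first exact: (invmx_Phi_sum Apos.1).
exact: (sum_Sset_lt1 Apos A1 A2 ker_u).
Qed.
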